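(* Let $k\geq 4$ and $d\geq 2$ be integers, and let $G$ be any finite simple graph with maximum degree $d$. Then $$s_k(G)\leq \left\lceil 6\sqrt{10}\, d^{\frac{k-1}{k-2}}\right\rceil .$$
   Context: $P_k$ denotes the path on $k$ vertices. A $P_k$-coloring of a graph $G$ is a proper vertex coloring of $G$ in which no copy of $P_k$ in $G$ (as a subgraph, not necessarily induced) is bicolored, i.e. has its vertices colored using only two colors. The $P_k$-chromatic number $s_k(G)$ is the minimum number of colors in a $P_k$-coloring of $G$. *)

(* Defs.v *)
From mathcomp Require Import all_boot.

Set Implicit Arguments.
Unset Strict Implicit.
Unset Printing Implicit Defensive.

(* A finite simple graph is a symmetric irreflexive relation [e] on a finite
   type [V] of vertices; the definitions below do not bundle these two
   properties. *)

Definition degree (V : finType) (e : rel V) (v : V) : nat :=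
  #|[set w | e v w]|.

Definition max_degree (V : finType) (e : rel V) : nat :=
  \max_(v : V) degree e v.

(* The vertices of a (not necessarily induced) copy of P_k, in path order:
   nothing is required of non-consecutive vertices. *)
Definition path_copy (V : finType) (e : rel V) (k : nat) (p : k.-tuple V) :
  bool := uniq p && sorted e p.

Definition proper_coloring (V : finType) (e : rel V) (C : finType)
  (f : {ffun V -> C}) : bool :=
  [forall u, forall v, e u v ==> (f u != f v)].

(* At most two colors; for a proper coloring and k >= 2 this means exactly
   two. *)
Definition bicolored (V C : finType) (f : {ffun V -> C}) (k : nat)
  (p : k.-tuple V) : bool :=
  #|[set f v | v in p]| <= 2.

Definition Pk_coloring (V : finType) (e : rel V) (k : nat) (C : finType)
  (f : {ffun V -> C}) : bool :=
  proper_coloring e f &&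
  [forall p : k.-tuple V, path_copy e p ==> ~~ bicolored f p].

Definition Pk_colorable (V : finType) (e : rel V) (k c : nat) : bool :=
  [exists f : {ffun V -> 'I_c}, Pk_coloring e k f].

(* When k >= 3, giving all vertices different colors is a P_k-coloring, so the
   minimum may be taken over c <= #|V|; see [Pk_chromatic_numberP]. For k <= 2
   a graph with a copy of P_k has no P_k-coloring, and the value is then the
   default #|V|. *)
Definition Pk_chromatic_number (V : finType) (e : rel V) (k : nat) : nat :=
  [arg min_(c < ord_max : 'I_#|V|.+1 | Pk_colorable e k c) (c : nat)].

Lemma Pk_colorable_card (V : finType) (e : rel V) (k : nat) :
  irreflexive e -> 2 < k -> Pk_colorable e k #|V|.
Proof.
move=> irr hk; apply/existsP; exists [ffun v => enum_rank v].
apply/andP; split.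
  apply/forallP => u; apply/forallP => v; apply/implyP => euv.
  rewrite !ffunE (inj_eq enum_rank_inj).
  by apply: contraTneq euv => ->; rewrite irr.
apply/forallP => p; apply/implyP => /andP[up _].
rewrite /bicolored card_imset; last first.
  by move=> x y; rewrite !ffunE => /enum_rank_inj.
by rewrite (card_uniqP up) size_tuple -ltnNge.
Qed.

Lemma Pk_chromatic_numberP (V : finType) (e : rel V) (k : nat) :
  irreflexive e -> 2 < k ->
  Pk_colorable e k (Pk_chromatic_number e k) /\
  (forall c, Pk_colorable e k c -> Pk_chromatic_number e k <= c).
Proof.
move=> irr hk; rewrite /Pk_chromatic_number.
case: arg_minnP => [|i Pi mini]; first exact: Pk_colorable_card.
split=> // c Pc; have [cV|Vc] := leqP c #|V|.
  by have := mini (Ordinal (cV : c < #|V|.+1)) Pc.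
by apply: leq_trans (ltnW Vc); rewrite -ltnS.
Qed.

(* Main.v *)
(* Counting in the style of Rosenfeld, with [D := ceil (d ^ ((k-1)/(k-2)))] and
   [5 * D] colors: adding a vertex v to a vertex set S multiplies the number of
   valid partial colorings by at least [2 * D]. Among the [5 * D] extensions of
   each coloring of S, at most d give v the color of a neighbor. A bicolored
   path through v is determined by the colors of two of its vertices other than
   v, so for each of the at most [k * d ^ (k-1)] paths, the bad extensions
   inject into the colorings of S minus k - 3 vertices, of which by induction
   there is at most a fraction [(2 * D) ^ -(k-3)]. Finally
   [d + k * d ^ (k-1) / (2 * D) ^ (k-3) <= 3 * D], and
   [5 * D <= 5 * (y + 1) <= 18 * y <= 6 * sqrt 10 * y] for
   [y := d ^ ((k-1)/(k-2)) >= 1]. *)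
Require Import Defs.
From HB Require Import structures.
From mathcomp Require Import all_boot all_order all_algebra.
From mathcomp Require Import zify lra.

(** * Counting the copies of P_k through a given vertex *)

Fixpoint walks {V : finType} (e : rel V) (n : nat) (x : V) : seq (seq V) :=
  if n is m.+1 then
    flatten [seq [seq y :: s | s <- walks e m y] | y <- enum [set w | e x w]]
  else [:: [::]].

Lemma walksP (V : finType) (e : rel V) (n : nat) (x : V) (s : seq V) :
  size s = n -> path e x s -> s \in walks e n x.
Proof.
elim: n x s => [|n IHn] x [|y s] //= [ss] /andP[exy es].
apply/flattenP; exists [seq y :: t | t <- walks e n y].
  by apply: map_f; rewrite mem_enum inE.
by apply: map_f; apply: IHn.
Qed.

Lemma size_flatten_leq (T : Type) (ss : seq (seq T)) (m : nat) :
  all (fun s => size s <= m) ss -> size (flatten ss) <= size ss * m.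
Proof.
elim: ss => //= s ss IHs /andP[sm /IHs ssm].
by rewrite size_cat mulSn leq_add.
Qed.

Lemma size_walks (V : finType) (e : rel V) (d n : nat) (x : V) :
  (forall v, degree e v <= d) -> size (walks e n x) <= d ^ n.
Proof.
move=> hd; elim: n x => [|n IHn] x //=.
rewrite expnS; apply: leq_trans (leq_mul (hd x) (leqnn (d ^ n))).
rewrite /degree cardE -(size_map (fun y => [seq y :: s | s <- walks e n y])).
apply: size_flatten_leq; apply/allP => _ /mapP[y _ ->].
by rewrite size_map.
Qed.

(** Cut a path at the position [i] of [v]: the reversed prefix and the suffix are walks from [v] of
    lengths [i] and [k.-1 - i], which leaves at most [d ^ k.-1] choices for each of the [k]
    positions. As [walks] omits the starting vertex, the pieces glue to [rev s ++ v :: t]. *)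
Lemma card_path_copy_through (V : finType) (e : rel V) (k d : nat) (v : V) :
  symmetric e -> (forall w, degree e w <= d) ->
  #|[set p : k.-tuple V | path_copy e p & v \in p]| <= k * d ^ k.-1.
Proof.
move=> esym hd.
pose L := flatten [seq [seq rev s ++ v :: t | s <- walks e i v,
                          t <- walks e (k.-1 - i) v] | i <- iota 0 k].
have sL : size L <= k * d ^ k.-1.
  rewrite -{1}(size_iota 0 k).
  rewrite -(size_map (fun i => [seq rev s ++ v :: t | s <- walks e i v,
                          t <- walks e (k.-1 - i) v])).
  apply: size_flatten_leq; apply/allP => _ /mapP[i + ->].
  rewrite mem_iota add0n => /andP[_ ik].
  rewrite size_allpairs.
  have -> : d ^ k.-1 = d ^ i * d ^ (k.-1 - i).
    by rewrite -expnD subnKC // -ltnS (ltn_predK ik).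
  by apply: leq_mul; apply: size_walks.
apply: leq_trans sL.
rewrite cardE -(size_map val); apply: uniq_leq_size.
  by rewrite (map_inj_uniq val_inj) enum_uniq.
move=> _ /mapP[[q sq] pW ->]; move: pW; rewrite mem_enum inE /=.
move=> /andP[/andP[_ /= eq_] vq]; apply/flattenP.
have {}vq : v \in q by [].
move/eqP: sq => sq.
case/splitPr: q / vq sq eq_ => s t; rewrite size_cat /= => sk est.
pose F i := [seq rev s' ++ v :: t' | s' <- walks e i v,
                                    t' <- walks e (k.-1 - i) v].
exists (F (size s)).
  by apply: (map_f F); rewrite mem_iota /= add0n -sk addnS ltnS leq_addr.
rewrite -[s in s ++ _]revK; apply: allpairs_f; apply: walksP.
- by rewrite size_rev.
(* Symmetry of [e] turns the prefix ending at [v] into a walk leaving [v]. *)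
- move: est; rewrite -cat_rcons.
  case/cat_sorted2 => + _; rewrite -(revK (rcons s v)) rev_sorted rev_rcons /=.
  by rewrite (eq_path (e' := e)) // => x y; rewrite esym.
- by rewrite -sk addnS /= addKn.
- by case/cat_sorted2: est.
Qed.

Lemma card_bigcup_leq (I T : finType) (P : {set I}) (F : I -> {set T}) :
  #|\bigcup_(i in P) F i| <= \sum_(i in P) #|F i|.
Proof.
elim/big_rec2: _ => [|i m A _ Am]; first by rewrite cards0.
by rewrite (leq_trans (leq_card_setU _ _)) ?leq_add2l.
Qed.

(** * Partial colorings, their one-vertex extensions, and the bad extensions *)

Section PartialColorings.
Context {V : finType} (e : rel V) (k : nat) {C : finType} (x0 : C).
Implicit Types (S T : {set V}) (f g : {ffun V -> C}) (p : k.-tuple V).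

Definition supported S f := [forall x, (x \notin S) ==> (f x == x0)].

Definition valid_on S f :=
  [forall u in S, forall w in S, e u w ==> (f u != f w)] &&
  [forall p : k.-tuple V, path_copy e p && all [in S] p ==> ~~ bicolored f p].

(* Colorings of [S] are total functions with the junk value [x0] outside [S]. *)
Definition partial_colorings S := [set f | supported S f && valid_on S f].

Lemma supportedP S f :
  reflect (forall x, x \notin S -> f x = x0) (supported S f).
Proof.
apply: (iffP forallP) => fS x; first by move=> xS; apply/eqP/(implyP (fS x)).
by apply/implyP => /fS ->.
Qed.

Lemma valid_onP S f :
  reflect ({in S &, forall u w, e u w -> f u != f w} /\
           (forall p, path_copy e p -> {subset p <= S} -> ~~ bicolored f p))
          (valid_on S f).
Proof.
apply: (iffP andP) => -[pf nf]; split.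
- move=> u w uS wS.
  by move/forall_inP: pf => /(_ u uS) /forall_inP /(_ w wS) /implyP.
- move=> p ep pS; apply: (implyP (forallP nf p)).
  by rewrite ep; apply/allP.
- apply/forall_inP => u uS; apply/forall_inP => w wS.
  by apply/implyP; apply: pf.
- apply/forallP => p; apply/implyP => /andP[ep /allP pS]; exact: nf.
Qed.

Lemma eq_bicolored f g p : {in p, f =1 g} -> bicolored f p = bicolored g p.
Proof. by move=> fg; rewrite /bicolored (eq_in_imset fg). Qed.

Lemma eq_valid_on S f g : {in S, f =1 g} -> valid_on S f -> valid_on S g.
Proof.
move=> fg /valid_onP[pf nf]; apply/valid_onP; split.
  by move=> u w uS wS; rewrite -!fg //; apply: pf.
move=> p ep pS; rewrite -(@eq_bicolored f) => [|x /pS /fg //].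
exact: nf.
Qed.

Lemma valid_on_sub S T f : T \subset S -> valid_on S f -> valid_on T f.
Proof.
move=> /subsetP TS /valid_onP[pf nf]; apply/valid_onP; split.
  by move=> u w uT wT; apply: pf; apply: TS.
by move=> p ep pT; apply: nf => // x /pT /TS.
Qed.

(** Cutting [g] down to [S], with [x0] elsewhere, maps [F] injectively into the partial colorings of
    [S]. Both bounds on bad extensions use this. *)
Lemma card_determined_leq S (F : {set {ffun V -> C}}) :
  {in F, forall g, valid_on S g} ->
  {in F &, forall f g, {in S, f =1 g} -> f = g} ->
  #|F| <= #|partial_colorings S|.
Proof.
move=> Fv Fi.
pose r g : {ffun V -> C} := [ffun x => if x \in S then g x else x0].
have rE g : {in S, r g =1 g} by move=> x xS; rewrite ffunE xS.
rewrite -(@card_in_imset _ _ r F).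
  apply: subset_leq_card; apply/subsetP => _ /imsetP[g gF ->].
  rewrite inE; apply/andP; split.
    by apply/supportedP => x /negbTE xS; rewrite ffunE xS.
  by apply: (@eq_valid_on _ g) (Fv _ gF) => x xS; rewrite rE.
by move=> f g fF gF fg; apply: Fi => // x xS; rewrite -rE // fg rE.
Qed.

(* Two vertices at positions of opposite parity determine the colors along a
   bicolored path. *)
Lemma bicolored_alternating f p (v : V) :
  path_copy e p -> {in p &, forall u w, e u w -> f u != f w} ->
  bicolored f p -> forall m, m < k -> f (nth v p m) = f (nth v p (odd m)).
Proof.
move=> /andP[_ sp] pf bf.
have np i : i < k -> nth v p i \in p by move=> ik; rewrite mem_nth ?size_tuple.
have step i : i.+1 < k -> f (nth v p i) != f (nth v p i.+1).
  move=> ik; apply: pf; rewrite ?np ?(ltnW ik) //.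
  by move/(sortedP v): sp; apply; rewrite size_tuple.
(* Neighbors on the path differ, so if the colors at [i] and [i.+2] differed too, three consecutive
   vertices would show three colors. *)
have step2 i : i.+2 < k -> f (nth v p i.+2) = f (nth v p i).
  move=> ik; apply/eqP; apply: contraTT bf => nii; rewrite /bicolored -ltnNge.
  pose s := [:: f (nth v p i); f (nth v p i.+1); f (nth v p i.+2)].
  have us : uniq s.
    by rewrite /= !inE negb_or !step ?(ltnW ik) // eq_sym nii.
  rewrite -[3]/(size s) -(card_uniqP us); apply: subset_leq_card.
  apply/subsetP => c; rewrite !inE => /or3P[] /eqP ->; apply: imset_f;
    apply: np => //; by rewrite ltnW ?(ltnW ik).
elim/ltn_ind => -[|[|m]] //= IHm mk.
by rewrite step2 // negbK IHm // ltnW // ltnW.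
Qed.

Definition extensions S (v : V) :=
  [set g | supported (v |: S) g && valid_on S g].

(** Any color may be given to [v]. The pair is recovered from the result because the original
    coloring has the value [x0] at [v]. *)
Lemma card_extensions S v : v \notin S ->
  #|C| * #|partial_colorings S| <= #|extensions S v|.
Proof.
move=> vS; pose h (fa : {ffun V -> C} * C) : {ffun V -> C} :=
  [ffun x => if x == v then fa.2 else fa.1 x].
rewrite mulnC -cardsT -cardsX -(@card_in_imset _ _ h).
  apply: subset_leq_card; apply/subsetP => _ /imsetP[[f a] + ->].
  rewrite !inE andbT /= => /andP[/supportedP sf vf]; apply/andP; split.
    apply/supportedP => x; rewrite !inE negb_or ffunE => /andP[/negbTE -> xS].
    exact: sf.
  apply: eq_valid_on vf => x xS; rewrite ffunE /=.
  by case: eqP xS vS => // -> ->.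
move=> [f a] [g b]; rewrite !inE !andbT /=.
move=> /andP[/supportedP sf _] /andP[/supportedP sg _] /ffunP fg.
have := fg v; rewrite !ffunE eqxx /= => ->; congr (_, _); apply/ffunP => x.
have := fg x; rewrite !ffunE /=; case: eqP => // -> _.
by rewrite sf ?sg.
Qed.

(** Replaces [bicolored] for bad extensions: these need not be proper at [v], and without properness
    two colors alone would not let two vertices determine the path. In [nth], [v] is only a
    default. *)
Definition alternating f p v := 
  [forall m : 'I_k, f (nth v p m) == f (nth v p (odd m))].

Definition clash S v (u : V) := [set g in extensions S v | g v == g u].

Definition bicolored_extensions S v p :=
  [set g in extensions S v | alternating g p v].

Definition paths_through S v :=
  [set p : k.-tuple V |
    [&& path_copy e p, v \in p & [set x in p] \subset v |: S]].

(** An extension without a clash at [v] is proper on [v |: S]. If it is still not valid, it has a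
    bicolored path; this path meets [v] by validity on [S], and it alternates by properness. *)
Lemma extensions_cover S v : v \notin S -> symmetric e -> irreflexive e ->
  extensions S v \subset
    partial_colorings (v |: S)
    :|: \bigcup_(u in [set u in S | e v u]) clash S v u
    :|: \bigcup_(p in paths_through S v) bicolored_extensions S v p.
Proof.
move=> vS esym eirr; apply/subsetP => g gE; rewrite !in_setU.
case: (boolP (g \in \bigcup_(u in [set u in S | e v u]) clash S v u)) => [_|nu].
  by rewrite orbT.
rewrite orbF; apply/orP.
have {}nu u : u \in S -> e v u -> g v != g u.
  move=> uS evu; apply: contraNneq nu => gvu.
  by apply/bigcupP; exists u; rewrite inE ?uS // gE; apply/eqP.
have := gE; rewrite inE => /andP[sg /valid_onP[pg ng]].
have pg' : {in v |: S &, forall u w, e u w -> g u != g w}.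
  move=> u w /setU1P[->|uS] /setU1P[->|wS]; first by rewrite eirr.
  - exact: nu.
  - by rewrite esym eq_sym; apply: nu.
  - exact: pg.
case: (boolP (g \in partial_colorings (v |: S))) => [|ngv]; first by left.
right; move: ngv; rewrite inE sg /= => nv.
have [p [ep pS bp]] : exists p,
    [/\ path_copy e p, {subset p <= v |: S} & bicolored g p].
  move: nv; rewrite negb_and => /orP[/negP[]|].
    apply/forall_inP => u uS; apply/forall_inP => w wS; apply/implyP.
    exact: pg'.
  rewrite negb_forall => /existsP[p]; rewrite negb_imply negbK.
  by move=> /andP[/andP[ep /allP pS] bp]; exists p.
have vp : v \in p.
  apply: contraTT bp => vp; apply: ng => // x xp.
  by have /setU1P[xv|//] := pS _ xp; rewrite -xv xp in vp.
apply/bigcupP; exists p.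
  by rewrite inE ep vp; apply/subsetP => x; rewrite inE => /pS.
rewrite inE gE; apply/forallP => m; apply/eqP.
apply: bicolored_alternating => // u w /pS uS /pS wS; exact: pg'.
Qed.

Lemma card_clash_leq S v u : v \notin S -> u \in S ->
  #|clash S v u| <= #|partial_colorings S|.
Proof.
move=> vS uS; apply: card_determined_leq => [g|f g].
  by rewrite !inE => /andP[/andP[]].
rewrite !inE => /andP[/andP[/supportedP sf _] /eqP fv].
move=> /andP[/andP[/supportedP sg _] /eqP gv] fg; apply/ffunP => x.
have [xv|xS] := boolP (x \in v |: S); last by rewrite sf ?sg.
by case/setU1P: xv => [->|/fg //]; rewrite fv gv fg.
Qed.

(** Keep two path vertices of opposite parity other than [v], and let [T] be the rest of the path
    without [v]. The colors on [S :\: T] fix the two kept colors, hence the whole path by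
    alternation. *)
Lemma card_alternating_leq S v p :
  3 < k -> v \notin S -> uniq p -> v \in p -> [set x in p] \subset v |: S ->
  exists T, [/\ T \subset S, #|T| = k - 3 &
    #|bicolored_extensions S v p| <= #|partial_colorings (S :\: T)|].
Proof.
move=> k4 vS up vp pS; pose q := nth v p.
have qp i : i < k -> q i \in p by move=> ik; rewrite mem_nth ?size_tuple.
have q_inj i j : i < k -> j < k -> q i = q j -> i = j.
  by move=> ik jk /eqP; rewrite nth_uniq ?size_tuple // => /eqP.
pose i := index v p.
have ik : i < k by rewrite -[X in _ < X](size_tuple p) index_mem.
have qi : q i = v by rewrite /q nth_index.
(* A position of parity [b] that avoids the position [i] of [v]: [b], or else [b + 2], which is at
   most 3 and so below [k]. *)
pose c (b : bool) : nat := if i == b then b.+2 else b.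
have ck b : c b < k.
  by rewrite /c; case: ifP => _; apply: leq_trans k4; case: b.
have odd_c b : odd (c b) = b by rewrite /c; case: ifP => _; case: b.
have ci b : c b != i.
  rewrite /c; case: (i =P b) => [->|/eqP]; last by rewrite eq_sym.
  by case: b.
(* This set still contains [v]; the witness given below is [T :\ v]. *)
pose T := [set x in p] :\ q (c true) :\ q (c false).
have cT b : q (c b) \notin T by case: b; rewrite !inE eqxx ?andbF.
have vT : v \in T.
  rewrite !inE vp andbT -qi; apply/andP; split.
    by apply: contraNneq (ci false) => /q_inj ->.
  by apply: contraNneq (ci true) => /q_inj ->.
have cardT : #|T| = k - 2.
  have c01 : q (c false) != q (c true).
    apply/eqP => /q_inj; rewrite !ck => /(_ isT isT) /(congr1 odd).
    by rewrite !odd_c.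
  have := cardsD1 (q (c true)) [set x in p].
  rewrite (cardsD1 (q (c false)) (_ :\ _)) -/T !inE c01 !qp //=.
  by rewrite cardsE (card_uniqP up) size_tuple => ->; rewrite !add1n subn2.
exists (T :\ v).
have TS : T :\ v \subset S.
  apply/subsetP => x; rewrite !inE => /and4P[xv _ _ xp].
  have : x \in v |: S by apply: (subsetP pS); rewrite inE.
  by rewrite !inE (negbTE xv).
split=> //.
  by rewrite subnS -cardT (cardsD1 v T) vT.
apply: card_determined_leq => [g|f g].
  rewrite !inE => /andP[/andP[_ +] _]; apply: valid_on_sub; exact: subsetDl.
rewrite !inE => /andP[/andP[/supportedP sf _] /forallP af].
move=> /andP[/andP[/supportedP sg _] /forallP ag] fg; apply/ffunP => x.
have [xv|xS] := boolP (x \in v |: S); last by rewrite sf ?sg.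
have fgT y : y \in v |: S -> y \notin T -> f y = g y.
  move=> yS yT; apply: fg; rewrite inE; have yv : y != v.
    by apply: contraNneq yT => ->.
  move: yS; rewrite !(inE, yv) (negbTE yv) /= => ->.
  by move: yT; rewrite !inE andbT.
have [xT|/fgT] := boolP (x \in T); last exact.
have xp : x \in p by move: xT; rewrite !inE => /and3P[].
have mk : index x p < k by rewrite -[X in _ < X](size_tuple p) index_mem.
have alt (h : {ffun V -> C}) :
    (forall m : 'I_k, h (nth v p m) == h (nth v p (odd m))) ->
    h x = h (q (c (odd (index x p)))).
  move=> ah; have /eqP := ah (Ordinal mk); rewrite /= nth_index // => ->.
  by have /eqP := ah (Ordinal (ck (odd (index x p)))); rewrite /= odd_c.
rewrite (alt f) ?(alt g) //; apply: fgT (cT _).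
by apply: (subsetP pS); rewrite inE qp.
Qed.

End PartialColorings.

(** * Growth of the number of partial colorings *)

Section Counting.
Context {V : finType} (e : rel V) (k d D : nat) {C : finType} (x0 : C).
Hypotheses (k_gt3 : 3 < k) (D_gt0 : 0 < D).
Hypotheses (esym : symmetric e) (eirr : irreflexive e).
Hypotheses (deg_le : forall v, degree e v <= d).
Hypotheses (d_le : d <= D) (dD : d ^ k.-1 <= D ^ (k - 2)).
Hypothesis cardC : 5 * D <= #|C|.

Local Notation PC := (partial_colorings e k x0).

(** The vertices of [T] are put back one at a time, each gaining a factor [2 * D]. Growth is assumed
    only for sets smaller than [n], so that an induction hypothesis can supply it. *)
Lemma card_partial_colorings_iter (n : nat) (S T : {set V}) :
  (forall (S' : {set V}) v, #|S'| < n -> v \notin S' ->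
     2 * D * #|PC S'| <= #|PC (v |: S')|) ->
  #|S| <= n -> T \subset S -> (2 * D) ^ #|T| * #|PC (S :\: T)| <= #|PC S|.
Proof.
move=> IH Sn; move: {2}#|T| (erefl #|T|) => m; elim: m T => [|m IHm] T cT TS.
  by move/eqP: cT; rewrite cards_eq0 => /eqP ->; rewrite cards0 mul1n setD0.
have [x xT] : exists x, x \in T by apply/card_gt0P; rewrite cT.
have xS := subsetP TS x xT.
have cT' : #|T :\ x| = m by move: cT; rewrite (cardsD1 x) xT add1n => -[].
apply: leq_trans (IHm _ cT' (subset_trans (subsetDl _ _) TS)).
have -> : S :\: (T :\ x) = x |: (S :\: T).
  by apply/setP => y; rewrite !inE; case: eqP => [->|] //=; rewrite xS.
rewrite cT cT' expnSr -mulnA leq_mul2l IH ?orbT //; last by rewrite !inE xT.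
apply: leq_trans Sn; apply: proper_card; apply/properP; split.
  exact: subsetDl.
by exists x => //; rewrite inE xT.
Qed.

Lemma path_count_leq : k * d ^ k.-1 <= 2 * D * (2 * D) ^ (k - 3).
Proof.
(* The powers of 2 absorb the factor [k]; equality holds at [k = 4]. *)
have k2 : k <= 2 ^ (k - 2).
  have -> : k - 2 = (k - 4).+2 by rewrite -!subSn // ltnW.
  rewrite -{1}(subnK k_gt3); elim: (k - 4) => // n IHn.
  rewrite expnS mul2n -addnn addSn -add1n leq_add //.
  by rewrite expn_gt0.
have -> : 2 * D * (2 * D) ^ (k - 3) = (2 * D) ^ (k - 2).
  by rewrite -expnS -subSn // ltnW.
by rewrite expnMn leq_mul.
Qed.

Lemma partial_colorings_growth (S : {set V}) (v : V) :
  v \notin S -> 2 * D * #|PC S| <= #|PC (v |: S)|.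
Proof.
move: {2}#|S|.+1 (ltnSn #|S|) => n; elim: n S v => // n IHn S v.
rewrite ltnS => Sn vS.
set N := #|PC S|; set N' := #|PC _|; pose B := (2 * D) ^ (k - 3).
have B_gt0 : 0 < B by rewrite expn_gt0 muln_gt0 D_gt0.
pose P := paths_through e k S v.
pose bad1 := clash e k x0 S v; pose bad2 := bicolored_extensions e k x0 S v.
have bad1_le : \sum_(u in [set u in S | e v u]) #|bad1 u| <= d * N.
  apply: (@leq_trans (\sum_(u in [set u in S | e v u]) N)).
    apply: leq_sum => u; rewrite inE => /andP[uS _].
    exact: card_clash_leq.
  rewrite sum_nat_const leq_mul2r (leq_trans _ (deg_le v)) ?orbT //.
  by apply: subset_leq_card; apply/subsetP => u; rewrite !inE => /andP[].
(* The bound is scaled by [B] to avoid division; unscaled, it is [2 * D * N]. *)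
have bad2_le : B * \sum_(p in P) #|bad2 p| <= 2 * D * B * N.
  apply: (@leq_trans (\sum_(p in P) N)).
    rewrite big_distrr; apply: leq_sum => p; rewrite inE.
    move=> /and3P[/andP[up _] vp pS].
    have [T [TS cT le_T]] :=
      card_alternating_leq e k x0 S v p k_gt3 vS up vp pS.
    apply: leq_trans (card_partial_colorings_iter _ S T IHn Sn TS).
    by rewrite cT leq_mul2l le_T orbT.
  rewrite sum_nat_const leq_mul2r; apply/orP; right.
  apply: leq_trans path_count_leq.
  apply: leq_trans (card_path_copy_through _ _ _ _ v esym deg_le).
  by apply: subset_leq_card; apply/subsetP => p; rewrite !inE => /and3P[-> ->].
have cover : 5 * D * N <=
    N' + \sum_(u in [set u in S | e v u]) #|bad1 u| + \sum_(p in P) #|bad2 p|.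
  apply: leq_trans (leq_mul cardC (leqnn _)) _.
  apply: leq_trans (card_extensions e k x0 S v vS) _.
  have := extensions_cover e k x0 S v vS esym eirr.
  move=> /subset_leq_card /leq_trans; apply.
  apply: leq_trans (leq_card_setU _ _) (leq_add _ (card_bigcup_leq _ _ _ _)).
  apply: leq_trans (leq_card_setU _ _) _.
  exact: leq_add (leqnn _) (card_bigcup_leq _ _ _ _).
(* After scaling by [B], the losses [d * N <= D * N] and [2 * D * N] are taken from [5 * D * N]. *)
rewrite -(leq_pmul2l B_gt0).
rewrite -(leq_add2r (B * (d * N) + 2 * D * B * N)).
apply: (@leq_trans (B * (5 * D * N))).
  have : B * (d * N) <= B * (D * N) by rewrite leq_mul2l leq_mul2r d_le !orbT.
  nia.
by nia.
Qed.

Lemma Pk_coloring_exists : exists f : {ffun V -> C}, Pk_coloring e k f.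
Proof.
have PC0 : 0 < #|PC set0|.
  apply/card_gt0P; exists [ffun=> x0]; rewrite inE; apply/andP; split.
    by apply/supportedP => x _; rewrite ffunE.
  apply/valid_onP; split=> [u w|p _ p0]; first by rewrite inE.
  (* A path has at least one vertex, so none lies inside the empty set. *)
  have /p0 : tnth p (Ordinal (ltnW (ltnW (ltnW k_gt3)))) \in p.
    exact: mem_tnth.
  by rewrite inE.
have /card_gt0P[f] : 0 < #|PC setT|.
  (* All of [V] is removed and put back, starting from the constant coloring counted in
     [PC set0]. *)
  apply: leq_trans (card_partial_colorings_iter #|V| setT setT _ _ (subxx _)).
  - by rewrite setDv muln_gt0 PC0 expn_gt0 muln_gt0 D_gt0.
  - by move=> S v _; apply: partial_colorings_growth.
  - by rewrite cardsT.
rewrite inE => /andP[_ /valid_onP[pf nf]]; exists f; apply/andP; split.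
  apply/forallP => u; apply/forallP => w; apply/implyP.
  by apply: pf; rewrite inE.
by apply/forallP => p; apply/implyP => ep; apply: nf => // x _; rewrite inE.
Qed.

End Counting.

(** * From the counting bound to the real-valued bound *)

Lemma Pk_colorable_mul5 (V : finType) (e : rel V) (k d D : nat) :
  3 < k -> 0 < d -> symmetric e -> irreflexive e -> max_degree e <= d ->
  d ^ k.-1 <= D ^ (k - 2) -> Pk_colorable e k (5 * D).
Proof.
move=> k3 d0 esym eirr hdeg dD.
(* Compare powers: [d ^ (k - 2) <= d ^ k.-1 <= D ^ (k - 2)]. *)
have dleD : d <= D.
  have k20 : 0 < k - 2 by rewrite subn_gt0 ltnW.
  rewrite -(leq_exp2r _ _ k20); apply: leq_trans dD.
  by rewrite leq_pexp2l // -subn1 leq_sub2l.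
have D0 := leq_trans d0 dleD.
have c0 : 0 < 5 * D by rewrite muln_gt0.
have degle v : degree e v <= d by apply: leq_trans hdeg; apply: leq_bigmax.
have [f ff] := Pk_coloring_exists e k d D (Ordinal c0) k3 D0 esym eirr degle
  dleD dD (eq_leq (Logic.eq_sym (card_ord _))).
by apply/existsP; exists f.
Qed.

(* Required only here: [classical_sets] shadows names of [finset] used above. *)
From mathcomp Require Import all_classical all_reals all_analysis.
Import Order.TTheory GRing.Theory Num.Theory.
Local Open Scope ring_scope.

Theorem theorem5 (R : realType) (k d : nat) (hk : (4 <= k)%N) (hd : (2 <= d)%N)
  (V : finType) (e : rel V) (esym : symmetric e) (eirr : irreflexive e)
  (hdeg : max_degree e = d) :
  (Pk_chromatic_number e k)%:Z <=
    Num.ceil (6 * Num.sqrt 10 *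
              (d%:R : R) `^ ((k%:R - 1) / (k%:R - 2))).
Proof.
set y := _ `^ _.
have kB2 : (k%:R - 2 : R) = (k - 2)%:R by rewrite natrB // ltnW // ltnW.
have y1 : 1 <= y.
  rewrite -(powRr0 (d%:R : R)) ler_powR ?ler1n ?(ltnW hd) //.
  by rewrite kB2 divr_ge0 ?ler0n // subr_ge0 ler1n ltnW // ltnW // ltnW.
(* Since [y >= 1], the ceiling is nonnegative and the absolute value changes nothing. *)
pose D := `|Num.ceil y|%N.
have DE : (D%:R : R) = (Num.ceil y)%:~R.
  by rewrite -[LHS]/((D%:Z)%:~R) gez0_abs // ceil_ge0; lra.
have yD : y <= D%:R by rewrite DE ceil_ge.
have Dy : D%:R <= y + 1 by rewrite DE; have := ceilB1_lt y; rewrite intrB; lra.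
(* The exponent is chosen so that [y ^+ (k - 2)] equals [d ^ k.-1]. *)
have dD : (d ^ k.-1 <= D ^ (k - 2))%N.
  rewrite -(ler_nat R) !natrX; apply: le_trans (_ : y ^+ (k - 2) <= _).
    rewrite -powR_mulrn ?powR_ge0 // -powRrM kB2 divfK; last first.
      by rewrite pnatr_eq0 subn_eq0 -ltnNge ltnW.
    have -> : (k%:R - 1 : R) = k.-1%:R.
      by rewrite -subn1 natrB // ltnW // ltnW // ltnW.
    by rewrite powR_mulrn.
  by rewrite lerXn2r // nnegrE ?powR_ge0.
have [_ min_c] := @Pk_chromatic_numberP V e k eirr (ltnW hk).
have le5D := min_c _ (Pk_colorable_mul5 V e k d D hk (ltnW hd) esym eirr
  (eq_leq hdeg) dD).
apply: (@le_trans _ _ (5 * D)%N%:Z); first by rewrite lez_nat.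
(* The integer [5 * D] is its own ceiling, so it suffices to compare the reals under the
   ceilings. *)
rewrite -[leLHS](@intrKceil R); apply: le_ceil.
have s3 : (3 : R) <= Num.sqrt 10.
  by rewrite -(@ler_pXn2r _ 2) ?nnegrE // sqr_sqrtr //; lra.
rewrite -pmulrn natrM.
have : 3 * y <= Num.sqrt 10 * y by rewrite ler_wpM2r // (le_trans _ y1).
lra.
Qed.
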